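(* Let $L\in(0,\infty)$, $\mu\in(-\infty,0]$, let $f\in\mathcal{F}_{\mu,L}(\mathbb{R}^n)$ with $f^\star:=\inf_{x\in\mathbb{R}^n} f(x)$ finite, let $x^1\in\mathbb{R}^n$ with $f(x^1)>f^\star$, and suppose that $f$ satisfies the Polyak-Łojasiewicz inequality with constant $\mu_p>0$ on $X=\{x\in\mathbb{R}^n: f(x)\le f(x^1)\}$. Let $t_1>0$ and $x^2=x^1-t_1\nabla f(x^1)$. (i) If $t_1\in\left(0,\tfrac{1}{L}\right)$, then $$\frac{f(x^2)-f^\star}{f(x^1)-f^\star}\le\left(\frac{\mu_p(1-Lt_1)+\sqrt{(L-\mu)(\mu-\mu_p)(2-Lt_1)\mu_p t_1+(L-\mu)^2}}{L-\mu+\mu_p}\right)^2.$$ (ii) If $t_1\in\left[\tfrac{1}{L},\tfrac{3}{\mu+L+\sqrt{\mu^2-L\mu+L^2}}\right]$, then $$\frac{f(x^2)-f^\star}{f(x^1)-f^\star}\le\frac{(Lt_1-2)(\mu t_1-2)\mu_p t_1}{(L+\mu-\mu_p)t_1-2}+1.$$ (iii) If $t_1\in\left(\tfrac{3}{\mu+L+\sqrt{\mu^2-L\mu+L^2}},\tfrac{2}{L}\right)$, then $$\frac{f(x^2)-f^\star}{f(x^1)-f^\star}\le\frac{(Lt_1-1)^2}{(Lt_1-1)^2+\mu_p t_1(2-Lt_1)}.$$ In particular, if $t_1=\tfrac1L$ and $\mu=-L$, then $$f(x^2)-f^\star\le\left(\frac{2L-2\mu_p}{2L+\mu_p}\ri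ght)\left(f(x^1)-f^\star\right).$$
   Context: $\|\cdot\|$ is the Euclidean norm on $\mathbb{R}^n$. For $L\in(0,\infty)$ and $\mu\in(-\infty,L)$, $\mathcal{F}_{\mu,L}(\mathbb{R}^n)$ denotes the set of differentiable functions $f:\mathbb{R}^n\to\mathbb{R}$ such that both $\tfrac{L}{2}\|\cdot\|^2-f$ and $f-\tfrac{\mu}{2}\|\cdot\|^2$ are convex. $f$ satisfies the Polyak-Łojasiewicz (PŁ) inequality with constant $\mu_p>0$ on $X\subseteq\mathbb{R}^n$ if $f(x)-f^\star\le\tfrac{1}{2\mu_p}\|\nabla f(x)\|^2$ for all $x\in X$, where $f^\star=\inf_{x\in\mathbb{R}^n} f(x)$. *)

(* Defs.v *)
(* MathComp world, with MathComp-Analysis. *)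
From HB Require Import structures.
From mathcomp Require Import all_boot all_order all_algebra.
From mathcomp Require Import all_classical all_reals all_analysis.

Set Implicit Arguments.
Unset Strict Implicit.
Unset Printing Implicit Defensive.

Import Order.TTheory GRing.Theory Num.Theory.
Import numFieldNormedType.Exports.

Local Open Scope classical_set_scope.
Local Open Scope ring_scope.

(* The library's norm `|x| on 'rV[R]_n is the sup norm, hence this definition.
   Both norms induce the same topology, so the library's (Fréchet)
   differentiability on 'rV[R]_n is the usual one on R^n. *)
Definition enorm (R : realType) (n : nat) (x : 'rV[R]_n) : R :=
  Num.sqrt (\sum_(i < n) (x 0 i) ^+ 2).

Definition grad (R : realType) (n : nat) (f : 'rV[R]_n -> R) (x : 'rV[R]_n) :
    'rV[R]_n :=
  \row_(i < n) 'D_(delta_mx 0 i) f x.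

Definition F_class (R : realType) (n : nat) (mu L : R) (f : 'rV[R]_n -> R) :
    Prop :=
  [/\ forall x, differentiable f x,
      convex_function setT (fun x : 'rV[R]_n => L / 2 * enorm x ^+ 2 - f x) &
      convex_function setT (fun x : 'rV[R]_n => f x - mu / 2 * enorm x ^+ 2)].

(* [inf] is real-valued, and is the infimum only when [f] is bounded below. *)
Definition inf_val (R : realType) (n : nat) (f : 'rV[R]_n -> R) : R :=
  inf (range f).

Definition PL_on (R : realType) (n : nat) (mu_p : R) (X : set 'rV[R]_n)
    (f : 'rV[R]_n -> R) : Prop :=
  forall x, X x -> f x - inf_val f <= (2 * mu_p)^-1 * enorm (grad f x) ^+ 2.

(* Main.v *)
Require Import Defs.
From HB Require Import structures.
From mathcomp Require Import all_boot all_order all_algebra.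
From mathcomp Require Import all_classical all_reals all_analysis.
From mathcomp Require Import ring lra.

Set Implicit Arguments.
Unset Strict Implicit.
Unset Printing Implicit Defensive.

Import Order.TTheory GRing.Theory Num.Theory.
Import numFieldNormedType.Exports.

Local Open Scope classical_set_scope.
Local Open Scope ring_scope.

(* Write [g1], [g2] for the gradients at [x1], [x2] and [F1], [F2] for the gaps
   to the infimum. Convexity of [L/2 |.|^2 - f] and [f - mu/2 |.|^2] gives
   quadratic upper and lower models of [f] at every point; confronting the
   lower model at one iterate with the upper model at the other yields two
   interpolation inequalities, linear in [F1], [F2] and the Gram matrix of
   [(g1, g2)]. Each rate is then a combination, with explicit nonnegative
   multipliers, of these inequalities, of the PL inequalities at [x1] and [x2]
   ([f x2 <= f x1] since [L * t1 < 2]) and of the square of a combination of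
   [g1] and [g2] that vanishes in the worst case. *)

(** * Euclidean inner product *)

Definition dot (R : realType) (n : nat) (u v : 'rV[R]_n) : R :=
  \sum_(i < n) u 0 i * v 0 i.

Section Dot.
Variables (R : realType) (n : nat).
Implicit Types u v w : 'rV[R]_n.

Lemma dotC u v : dot u v = dot v u.
Proof. by apply: eq_bigr => i _; rewrite mulrC. Qed.

Lemma dotDl u v w : dot (u + v) w = dot u w + dot v w.
Proof. by rewrite -big_split; apply: eq_bigr => i _; rewrite mxE mulrDl. Qed.

Lemma dotZl k u v : dot (k *: u) v = k * dot u v.
Proof. by rewrite mulr_sumr; apply: eq_bigr => i _; rewrite mxE mulrA. Qed.

Lemma dotDr u v w : dot w (u + v) = dot w u + dot w v.
Proof. by rewrite dotC dotDl !(dotC w). Qed.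

Lemma dotZr k u v : dot u (k *: v) = k * dot u v.
Proof. by rewrite dotC dotZl dotC. Qed.

Lemma dotNl u v : dot (- u) v = - dot u v.
Proof. by rewrite -scaleN1r dotZl mulN1r. Qed.

Lemma dotNr u v : dot u (- v) = - dot u v.
Proof. by rewrite dotC dotNl dotC. Qed.

Lemma dot_ge0 u : 0 <= dot u u.
Proof. by apply: sumr_ge0 => i _; rewrite -expr2 sqr_ge0. Qed.

Lemma enorm_sqr u : enorm u ^+ 2 = dot u u.
Proof.
rewrite /enorm sqr_sqrtr; first by apply: eq_bigr => i _; rewrite expr2.
by apply: sumr_ge0 => i _; rewrite sqr_ge0.
Qed.

(** * Quadratic models and interpolation from convexity *)

Lemma derive_grad (f : 'rV[R]_n -> R) x v :
  differentiable f x -> 'D_v f x = dot (grad f x) v.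
Proof.
move=> df; rewrite deriveE // [in LHS](row_sum_delta v) linear_sum.
apply: eq_bigr => i _; rewrite linearZ mxE deriveE //.
by rewrite mulrC.
Qed.

(* Convexity bounds the slopes of [k |.|^2 + s f] from [x] towards [x + v] by
   the full increment; let the step tend to [0]. *)
Lemma convex_derive_le (f : 'rV[R]_n -> R) (s k : R) (x v : 'rV[R]_n) :
  0 <= k -> derivable f x v ->
  convex_function setT (fun z : 'rV[R]_n => s * f z + k * enorm z ^+ 2) ->
  s * 'D_v f x <= s * (f (x + v) - f x) + k * dot v v.
Proof.
move=> k_ge0 df cvx.
have slope_le (h : R) : 0 < h -> h < 1 ->
    s * (h^-1 * (f (h *: v + x) - f x))
      <= s * (f (x + v) - f x) + k * dot v v.
  move=> h_gt0 h_lt1.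
  have := cvx (@Itv01 R h (ltW h_gt0) (ltW h_lt1)) (x + v) x.
  rewrite !inE => /(_ I I) /=; rewrite [leRHS]convRE /=.
  have -> : conv (@Itv01 R h (ltW h_gt0) (ltW h_lt1))
      (x + v : convex_lmodType 'rV[R]_n) x = h *: v + x.
    have : h *: (x + v) + (1 - h) *: x = h *: v + x.
      by rewrite scalerDr scalerBl scale1r addrC addrA subrK addrC.
    exact.
  rewrite !enorm_sqr !(dotDl, dotDr, dotZl, dotZr) (dotC v x) => le_h.
  rewrite mulrCA mulrC ler_pdivrMr //.
  (* The cross terms [dot x v] cancel; this surplus on the smaller side of [le_h] is discarded. *)
  have : 0 <= h ^+ 2 * (k * dot v v).
    apply: mulr_ge0; first exact: sqr_ge0.
    by apply: mulr_ge0 => //; exact: dot_ge0.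
  rewrite -[unstable.onem h]/(1 - h) in le_h; lra.
have cv : s * (h^-1 * (f (h *: v + x) - f x)) @[h --> 0^'+] --> s * 'D_v f x.
  apply: cvg_dnbhs_at_right; apply: cvgMr; exact: df.
apply: (cvgr_to_le cv).
near=> h; apply: slope_le; near: h.
  exact: nbhs_right_gt.
exact: nbhs_right_lt.
Unshelve. all: by end_near.
Qed.

(** The descent lemma: [convex_derive_le] with [s = -1] and [k = L / 2]. *)
Lemma F_class_upper (mu L : R) (f : 'rV[R]_n -> R) x v :
  0 <= L -> F_class mu L f ->
  f (x + v) <= f x + dot (grad f x) v + L / 2 * dot v v.
Proof.
move=> L_ge0 [df cvx _].
have dfxv : derivable f x v by exact: diff_derivable.
have /(_ (L / 2)) := convex_derive_le (s := -1) _ dfxv.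
rewrite derive_grad // divr_ge0 // => /(_ isT).
have -> : (fun z => -1 * f z + L / 2 * enorm z ^+ 2)
  = (fun z => L / 2 * enorm z ^+ 2 - f z).
  by apply/funext => z; rewrite mulN1r addrC.
move=> /(_ cvx); lra.
Qed.

(** [convex_derive_le] with [s = 1] and [k = - mu / 2], nonnegative as [mu <= 0]. *)
Lemma F_class_lower (mu L : R) (f : 'rV[R]_n -> R) x v :
  mu <= 0 -> F_class mu L f ->
  f x + dot (grad f x) v + mu / 2 * dot v v <= f (x + v).
Proof.
move=> mu_le0 [df _ cvx].
have dfxv : derivable f x v by exact: diff_derivable.
have /(_ (- mu / 2)) := convex_derive_le (s := 1) _ dfxv.
rewrite derive_grad // divr_ge0 ?oppr_ge0 // => /(_ isT).
have -> : (fun z => 1 * f z + - mu / 2 * enorm z ^+ 2)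
  = (fun z => f z - mu / 2 * enorm z ^+ 2).
  by apply/funext => z; rewrite mul1r !mulNr.
move=> /(_ cvx); lra.
Qed.

(* Compare the lower quadratic model at [x] with the upper one at [y] in the
   point where their gap is smallest. *)
Lemma F_class_interpolation (mu L : R) (f : 'rV[R]_n -> R) x y w :
  mu <= 0 -> 0 < L -> F_class mu L f ->
  w = grad f y - grad f x - mu *: (y - x) ->
  dot w w + (L - mu) * mu * dot (y - x) (y - x)
    <= 2 * (L - mu) * (f y - f x - dot (grad f x) (y - x)).
Proof.
move=> mu_le0 L_gt0 fF wE.
have Lmu_gt0 : 0 < L - mu by lra.
have [d dE] : exists d, d = y - x by exists (y - x).
(* At [y + u] the gap between the models has gradient [w + (L - mu) u], so [u = - k w] minimizes
   it. *)
set k := (L - mu)^-1; rewrite -dE in wE *.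
have gyE : grad f y = grad f x + w + mu *: d.
  by rewrite wE -addrA subrK addrC subrK.
have := F_class_lower x (d - k *: w) mu_le0 fF.
have := F_class_upper y (- k *: w) (ltW L_gt0) fF.
have -> : x + (d - k *: w) = y + - k *: w.
  by rewrite dE scaleNr addrA [x + _]addrC subrK.
move=> up low; have {up low} := le_trans low up.
rewrite gyE -scaleNr !(dotDl, dotDr, dotZl, dotZr).
rewrite (dotC w d) -[in X in X -> _]subr_ge0 -[in X in _ -> X]subr_ge0.
move=> /(mulr_ge0 (ltW (mulr_gt0 (ltr0n R 2) Lmu_gt0))).
move: (dot w w) (dot d w) (dot d d) (dot (grad f x) w) (dot (grad f x) d).
move: (f x) (f y) => fx fy ww dw dd gw gd.
congr (0 <= _).
by rewrite /k; field; rewrite gt_eqF.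
Qed.
End Dot.

(** * Real inequalities behind the three rates *)

Section Rates.
Variables (R : rcfType) (L mu mu_p t F1 F2 a b c : R).
(** [a], [b], [c] stand for [|g1|^2], [|g2|^2], [<g1, g2>]. [Q] is the left side of the
    interpolation inequality for a step [t]; swapping the iterates only flips the sign of [w], so
    both orders share it. *)
Let Q := (1 + L * mu * t ^+ 2 - 2 * mu * t) * a - 2 * (1 - mu * t) * c + b.

(* The threshold is the only positive root of the quadratic. *)
Lemma step_threshold_ltE :
  0 < L -> mu <= 0 -> 0 < t ->
  (3 / (mu + L + Num.sqrt (mu ^+ 2 - L * mu + L ^+ 2)) < t) =
    (0 < - (L * mu) * t ^+ 2 + 2 * (L + mu) * t - 3).
Proof.
move=> L_gt0 mu_le0 t_gt0; set S := Num.sqrt _.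
have r_ge0 : 0 <= mu ^+ 2 - L * mu + L ^+ 2 by nra.
have S2 : S ^+ 2 = mu ^+ 2 - L * mu + L ^+ 2 by rewrite sqr_sqrtr.
have S_ge0 : 0 <= S by exact: sqrtr_ge0.
have Lmu_le0 : L * mu <= 0 by nra.
have D_gt0 : 0 < mu + L + S by nra.
have D'_le0 : mu + L - S <= 0 by nra.
rewrite ltr_pdivrMr //.
(* As [mu + L <= S], the second factor is at least 3, and the first carries the sign. *)
have E : 3 * (- (L * mu) * t ^+ 2 + 2 * (L + mu) * t - 3)
  = (t * (mu + L + S) - 3) * (3 - t * (mu + L - S)).
  by ring: S2.
rewrite -[in RHS](pmulr_rgt0 _ (ltr0n R 3)) E pmulr_lgt0 ?subr_gt0 //.
have : 0 <= t * (S - mu - L) by apply: mulr_ge0; lra.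
lra.
Qed.

Lemma middle_step_rate :
  0 < L -> mu <= 0 -> 0 < mu_p -> 0 < t -> 0 < F1 ->
  2 * mu_p * F1 <= a -> 2 * mu_p * F2 <= b ->
  Q <= 2 * (L - mu) * (F2 - F1 + t * a) ->
  Q <= 2 * (L - mu) * (F1 - F2 - t * c) ->
  1 <= L * t -> - (L * mu) * t ^+ 2 + 2 * (L + mu) * t - 3 <= 0 ->
  F2 / F1 <=
    (L * t - 2) * (mu * t - 2) * mu_p * t / ((L + mu - mu_p) * t - 2) + 1.
Proof.
move=> L_gt0 mu_le0 mu_p_gt0 t_gt0 F1_gt0 PL1 PL2 int12 int21 Lt_ge1 p_le0.
have Lmu_gt0 : 0 < L - mu by lra.
have mut : 0 <= - mu * t by nra.
(* The quadratic equals [- mu t (L t - 2) + 2 L t - 3], which would be positive if [L t >= 2]. *)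
have Lt_lt2 : L * t < 2 by rewrite ltNge; apply/negP => ?; nra.
(* The denominator of the rate is negative; its opposite is used to clear it. *)
have D_gt0 : 0 < 2 - (L + mu - mu_p) * t by nra.
have h1 : 0 <= (1 - mu * t) * (2 * (L - mu) * (F1 - F2 - t * c) - Q).
  by apply: mulr_ge0; lra.
have h2 : 0 <= (L * t - 1) * (2 * (L - mu) * (F2 - F1 + t * a) - Q).
  by apply: mulr_ge0; lra.
have h3 : 0 <= (L - mu) * t * (3 - 2 * (L + mu) * t + L * mu * t ^+ 2)
                 * (a - 2 * mu_p * F1).
  by rewrite !mulr_ge0 //; lra.
have h4 : 0 <= (L - mu) * t * (b - 2 * mu_p * F2).
  by rewrite !mulr_ge0 //; lra.
rewrite ler_pdivrMr // -subr_ge0.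
rewrite -(pmulr_rge0 _ (mulr_gt0 D_gt0 (mulr_gt0 (ltr0n R 2) Lmu_gt0))).
suff -> : (2 - (L + mu - mu_p) * t) * (2 * (L - mu)) *
  (((L * t - 2) * (mu * t - 2) * mu_p * t / ((L + mu - mu_p) * t - 2) + 1) *
   F1 - F2) =
   (1 - mu * t) * (2 * (L - mu) * (F1 - F2 - t * c) - Q) +
   (L * t - 1) * (2 * (L - mu) * (F2 - F1 + t * a) - Q) +
   (L - mu) * t * (3 - 2 * (L + mu) * t + L * mu * t ^+ 2)
                 * (a - 2 * mu_p * F1) +
   (L - mu) * t * (b - 2 * mu_p * F2) by rewrite !addr_ge0.
rewrite /Q; field; lra.
Qed.

Lemma long_step_rate :
  0 < L -> mu <= 0 -> 0 < mu_p -> 0 < t -> 0 < F1 ->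
  2 * mu_p * F2 <= b ->
  (forall x y, 0 <= a * x ^+ 2 + 2 * c * x * y + b * y ^+ 2) ->
  Q <= 2 * (L - mu) * (F2 - F1 + t * a) ->
  Q <= 2 * (L - mu) * (F1 - F2 - t * c) ->
  0 <= - (L * mu) * t ^+ 2 + 2 * (L + mu) * t - 3 ->
  1 <= L * t -> L * t < 2 ->
  F2 / F1 <=
    (L * t - 1) ^+ 2 / ((L * t - 1) ^+ 2 + mu_p * t * (2 - L * t)).
Proof.
move=> L_gt0 mu_le0 mu_p_gt0 t_gt0 F1_gt0 PL2 gram_ge0 int12 int21 p_ge0.
move=> Lt_ge1 Lt_lt2.
have Lmu_gt0 : 0 < L - mu by lra.
set s := L * t - 1.
have e_gt0 : 0 < mu_p * t * (2 - L * t) by rewrite !mulr_gt0 //; lra.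
have D_gt0 : 0 < s ^+ 2 + mu_p * t * (2 - L * t).
  by rewrite ltr_wpDl // sqr_ge0.
have s_ge0 : 0 <= s by rewrite /s; lra.
have h1 : 0 <= (s ^+ 2 + s * (2 - L * t)) *
    (2 * (L - mu) * (F1 - F2 - t * c) - Q).
  by apply: mulr_ge0; nra.
have h2 : 0 <= s * (2 - L * t) * (2 * (L - mu) * (F2 - F1 + t * a) - Q).
  by apply: mulr_ge0; nra.
have h4 : 0 <= (L - mu) * t * (2 - L * t) * (b - 2 * mu_p * F2).
  by rewrite !mulr_ge0 //; lra.
(* The second factor is [|s g1 + g2|^2], zero when [g2 = - s g1]. *)
have h5 : 0 <= (- (L * mu) * t ^+ 2 + 2 * (L + mu) * t - 3) *
  (a * s ^+ 2 + 2 * c * s * 1 + b * 1 ^+ 2).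
  by rewrite mulr_ge0.
rewrite ler_pdivrMr // -subr_ge0.
rewrite -(pmulr_rge0 _ (mulr_gt0 D_gt0 (mulr_gt0 (ltr0n R 2) Lmu_gt0))).
suff -> : (s ^+ 2 + mu_p * t * (2 - L * t)) * (2 * (L - mu)) *
  (s ^+ 2 / (s ^+ 2 + mu_p * t * (2 - L * t)) * F1 - F2) =
  (s ^+ 2 + s * (2 - L * t)) * (2 * (L - mu) * (F1 - F2 - t * c) - Q) +
  s * (2 - L * t) * (2 * (L - mu) * (F2 - F1 + t * a) - Q) +
  (L - mu) * t * (2 - L * t) * (b - 2 * mu_p * F2) +
   (- (L * mu) * t ^+ 2 + 2 * (L + mu) * t - 3) *
  (a * s ^+ 2 + 2 * c * s * 1 + b * 1 ^+ 2) by rewrite !addr_ge0.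
rewrite /Q /s; field; rewrite -/s; lra.
Qed.

Lemma short_step_rate :
  0 < L -> mu <= 0 -> 0 < mu_p -> 0 < t -> 0 < F1 ->
  2 * mu_p * F1 <= a -> 2 * mu_p * F2 <= b ->
  (forall x y, 0 <= a * x ^+ 2 + 2 * c * x * y + b * y ^+ 2) ->
  Q <= 2 * (L - mu) * (F1 - F2 - t * c) ->
  mu_p <= L -> L * t < 1 ->
  F2 / F1 <=
   ((mu_p * (1 - L * t) +
          Num.sqrt ((L - mu) * (mu - mu_p) * (2 - L * t) * mu_p * t
                    + (L - mu) ^+ 2))
         / (L - mu + mu_p)) ^+ 2.
Proof.
move=> L_gt0 mu_le0 mu_p_gt0 t_gt0 F1_gt0 PL1 PL2 gram_ge0 int21 mu_p_leL.
move=> Lt_lt1.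
have Lmu_gt0 : 0 < L - mu by lra.
set w := 1 - L * t; set r := (X in Num.sqrt X); set q := (X in X ^+ 2).
have w_gt0 : 0 < w by rewrite /w; lra.
have w_le1 : w <= 1 by rewrite /w gerBl mulr_ge0 // ltW.
have e_ge0 : 0 <= (2 - L * t) * t by rewrite mulr_ge0; lra.
(* The last factor is [(L - mu_p) (L + mu_p - mu)], nonnegative since [mu_p <= L]. The resulting
   bound on [r] yields [w <= q], the sign of a multiplier below. *)
have rE : r = ((L - mu) * w) ^+ 2
   + (2 - L * t) * t * (L - mu) * ((mu - mu_p) * mu_p + (L - mu) * L).
  by rewrite /r /w; ring.
have r_lb : ((L - mu) * w) ^+ 2 <= r.
  rewrite rE lerDl; apply: mulr_ge0; last nra.
  by apply: mulr_ge0; lra.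
have r_ub : r <= (L - mu) ^+ 2.
  rewrite /r gerDr.
  have -> : (L - mu) * (mu - mu_p) * (2 - L * t) * mu_p * t =
    - ((L - mu) * (mu_p - mu) * ((2 - L * t) * t) * mu_p) by ring.
  by rewrite oppr_le0 !mulr_ge0 //; lra.
have r_ge0 : 0 <= r by apply: le_trans r_lb; exact: sqr_ge0.
have S_lb : (L - mu) * w <= Num.sqrt r.
  rewrite -(ler_pXn2r (ltn0Sn 1)) ?nnegrE ?sqrtr_ge0 ?sqr_sqrtr //.
  by rewrite mulr_ge0; lra.
have S_ub : Num.sqrt r <= L - mu.
  rewrite -(ler_pXn2r (ltn0Sn 1)) ?nnegrE ?sqrtr_ge0 ?sqr_sqrtr //; lra.
have D_gt0 : 0 < L - mu + mu_p by lra.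
have qD : q * (L - mu + mu_p) = mu_p * w + Num.sqrt r.
  by rewrite /q divfK // gt_eqF.
have q_ge : w <= q by rewrite ler_pdivlMr //; lra.
have q_le1 : q <= 1 by rewrite ler_pdivrMr //; nra.
have q_gt0 : 0 < q by lra.
(* [q] is a root of the quadratic met when [g2 = q g1] and both PL inequalities
   and the interpolation inequality are tight. *)
have qE : (L - mu + mu_p) * q ^+ 2 = 2 * mu_p * w * q + L - mu
     - mu_p * (1 + L * mu * t ^+ 2 - 2 * mu * t).
  apply: (mulfI (lt0r_neq0 D_gt0)).
  have -> : (L - mu + mu_p) * ((L - mu + mu_p) * q ^+ 2)
    = (q * (L - mu + mu_p)) ^+ 2 by ring.
  have S2 : Num.sqrt r ^+ 2 = r by rewrite sqr_sqrtr.
  have rq : Num.sqrt r = q * (L - mu + mu_p) - mu_p * w.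
    by rewrite qD addrC addKr.
  move: S2; rewrite rq; rewrite /r /w; move: (q) => z; lra.
have h1 : 0 <= q * (2 * (L - mu) * (F1 - F2 - t * c) - Q).
  by rewrite mulr_ge0; lra.
have h3 : 0 <= q * (1 + L * mu * t ^+ 2 - 2 * mu * t - q * w) *
    (a - 2 * mu_p * F1).
  rewrite mulr_ge0 //; last lra.
  rewrite mulr_ge0 //; first lra.
  (* The multiplier splits as [L t + (w - q w) - mu t (2 - L t)]. *)
  have : q * w <= w by nra.
  have : 0 <= - mu * ((2 - L * t) * t) by nra.
  have : 0 < L * t by rewrite mulr_gt0.
  rewrite /w; lra.
have h4 : 0 <= (q - w) * (b - 2 * mu_p * F2).
  by rewrite mulr_ge0; lra.
(* The second factor is [|q g1 - g2|^2]. *)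
have h5 : 0 <= w * (a * q ^+ 2 + 2 * c * q * (-1) + b * (-1) ^+ 2).
  by rewrite mulr_ge0 // ltW.
have K_gt0 : 0 < 2 * q * (L - mu) + 2 * mu_p * (q - w).
  have : 0 < q * (L - mu) by rewrite mulr_gt0.
  have : 0 <= mu_p * (q - w) by rewrite mulr_ge0; lra.
  lra.
rewrite ler_pdivrMr // -subr_ge0 -(pmulr_rge0 _ K_gt0).
suff -> : (2 * q * (L - mu) + 2 * mu_p * (q - w)) * (q ^+ 2 * F1 - F2) =
   q * (2 * (L - mu) * (F1 - F2 - t * c) - Q) +
   q * (1 + L * mu * t ^+ 2 - 2 * mu * t - q * w) * (a - 2 * mu_p * F1) +
   (q - w) * (b - 2 * mu_p * F2) +
   w * (a * q ^+ 2 + 2 * c * q * (-1) + b * (-1) ^+ 2) by rewrite !addr_ge0.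
(* The two sides agree only modulo [qE], which enters with coefficient [2 q F1]. *)
have := congr1 ( *%R (2 * q * F1)) qE.
rewrite /Q /w; move: (q) => z; lra.
Qed.
End Rates.

(** * Application to one gradient step *)

Theorem theorem3 (R : realType) (n : nat) (L mu mu_p t1 : R)
    (f : 'rV[R]_n -> R) (x1 x2 : 'rV[R]_n)
    (L_gt0 : 0 < L) (mu_le0 : mu <= 0)
    (f_in_class : F_class mu L f)
    (fstar_finite : has_inf (range f))
    (x1_subopt : inf_val f < f x1)
    (mu_p_gt0 : 0 < mu_p)
    (f_PL : PL_on mu_p [set x | f x <= f x1] f)
    (t1_gt0 : 0 < t1)
    (x2_def : x2 = x1 - t1 *: grad f x1) :
  let fstar := inf_val f in
  let tbar := 3 / (mu + L + Num.sqrt (mu ^+ 2 - L * mu + L ^+ 2)) in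
  [/\ (* (i) *)
      t1 < 1 / L ->
      (f x2 - fstar) / (f x1 - fstar) <=
        ((mu_p * (1 - L * t1) +
          Num.sqrt ((L - mu) * (mu - mu_p) * (2 - L * t1) * mu_p * t1
                    + (L - mu) ^+ 2))
         / (L - mu + mu_p)) ^+ 2,
      (* (ii) *)
      1 / L <= t1 -> t1 <= tbar ->
      (f x2 - fstar) / (f x1 - fstar) <=
        (L * t1 - 2) * (mu * t1 - 2) * mu_p * t1
          / ((L + mu - mu_p) * t1 - 2) + 1,
      (* (iii) *)
      tbar < t1 -> t1 < 2 / L ->
      (f x2 - fstar) / (f x1 - fstar) <=
        (L * t1 - 1) ^+ 2
          / ((L * t1 - 1) ^+ 2 + mu_p * t1 * (2 - L * t1)) &
      (* in particular *)
      t1 = 1 / L -> mu = - L ->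
      f x2 - fstar <=
        (2 * L - 2 * mu_p) / (2 * L + mu_p) * (f x1 - fstar)].

Proof.
move=> fstar tbar.
set F1 := f x1 - fstar; set F2 := f x2 - fstar.
set g1 := grad f x1; set g2 := grad f x2.
have F1_gt0 : 0 < F1 by rewrite subr_gt0.
have fstar_le y : fstar <= f y.
  by apply: ge_inf; [case: fstar_finite | exists y].
have PLE x : f x <= f x1 ->
    2 * mu_p * (f x - fstar) <= dot (grad f x) (grad f x).
  move=> /f_PL; rewrite enorm_sqr -/fstar -ler_pdivlMl //.
  by rewrite mulr_gt0.
(* A step of length [1 / L] from [x1] stays above [fstar], so [|g1|^2 <= 2 L F1]; compare with PL at
   [x1]. *)
have mu_p_leL : mu_p <= L.
  have := F_class_upper x1 (- L^-1 *: g1) (ltW L_gt0) f_in_class.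
  move=> /(le_trans (fstar_le _)); rewrite !(dotZl, dotZr) -/g1 => le_up.
  have PL1 := PLE x1 (lexx _).
  have : dot g1 g1 <= 2 * L * F1.
    rewrite -subr_ge0 in le_up.
    have := mulr_ge0 (ltW (mulr_gt0 (ltr0n R 2) L_gt0)) le_up.
    rewrite -[in X in _ -> X]subr_ge0; congr (0 <= _).
    by rewrite /F1; field; rewrite gt_eqF.
  move=> /(le_trans PL1); rewrite -/F1 ler_pM2r // ler_pM2l //.
have Lt2P : (t1 < 2 / L) = (L * t1 < 2) by rewrite ltr_pdivlMr // mulrC.
(* This puts [x2] in the sublevel set where PL is available. *)
have descent : L * t1 < 2 -> f x2 <= f x1.
  move=> Lt_lt2.
  have := F_class_upper x1 (- t1 *: g1) (ltW L_gt0) f_in_class.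
  rewrite !(dotZl, dotZr) -/g1 scaleNr -x2_def => le_up.
  have : 0 <= (t1 * (2 - L * t1)) * dot g1 g1.
    by apply: mulr_ge0; [apply: mulr_ge0; lra | exact: dot_ge0].
  lra.
have gram_ge0 (x y : R) : 0 <= dot g1 g1 * x ^+ 2 + 2 * dot g1 g2 * x * y
                            + dot g2 g2 * y ^+ 2.
  have := dot_ge0 (x *: g1 + y *: g2).
  rewrite !(dotDl, dotDr, dotZl, dotZr) (dotC g2 g1); lra.
have x21 : x2 - x1 = - t1 *: g1 by rewrite x2_def addrAC subrr add0r scaleNr.
have x12 : x1 - x2 = t1 *: g1 by rewrite -opprB x21 scaleNr opprK.
pose Q := (1 + L * mu * t1 ^+ 2 - 2 * mu * t1) * dot g1 g1
  - 2 * (1 - mu * t1) * dot g1 g2 + dot g2 g2.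
have int12 : Q <= 2 * (L - mu) * (F2 - F1 + t1 * dot g1 g1).
  have := F_class_interpolation mu_le0 L_gt0 f_in_class
    (erefl (g2 - g1 - mu *: (x2 - x1))).
  rewrite x21 !(dotDl, dotDr, dotNl, dotNr, dotZl, dotZr) (dotC g2 g1).
  rewrite -/g1 /Q /F1 /F2; lra.
have int21 : Q <= 2 * (L - mu) * (F1 - F2 - t1 * dot g1 g2).
  have := F_class_interpolation mu_le0 L_gt0 f_in_class
    (erefl (g1 - g2 - mu *: (x1 - x2))).
  rewrite x12 -/g2 !(dotDl, dotDr, dotNl, dotNr, dotZl, dotZr) (dotC g2 g1).
  rewrite /Q /F1 /F2; lra.
have tbar_lt := step_threshold_ltE L_gt0 mu_le0 t1_gt0.
have PL1 := PLE x1 (lexx _).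
have middle : 1 <= L * t1 -> t1 <= tbar -> F2 / F1 <=
    (L * t1 - 2) * (mu * t1 - 2) * mu_p * t1 / ((L + mu - mu_p) * t1 - 2) + 1.
  move=> Lt_ge1; rewrite leNgt tbar_lt -leNgt => p_le0.
  have Lt_lt2 : L * t1 < 2.
    rewrite ltNge; apply/negP => Lt_ge2.
    have : 0 <= - mu * t1 * (L * t1 - 2) by rewrite !mulr_ge0 //; lra.
    lra.
  have PL2 := PLE x2 (descent Lt_lt2).
  exact: middle_step_rate PL1 PL2 int12 int21 Lt_ge1 p_le0.
have Lt1P : (1 / L <= t1) = (1 <= L * t1) by rewrite ler_pdivrMr // mulrC.
split.
- rewrite ltr_pdivlMr // mulrC => Lt_lt1.
  have Lt_lt2 : L * t1 < 2 by lra.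
  have PL2 := PLE x2 (descent Lt_lt2).
  exact: short_step_rate PL1 PL2 gram_ge0 int21 mu_p_leL Lt_lt1.
- by rewrite Lt1P; exact: middle.
- rewrite tbar_lt Lt2P => p_gt0 Lt_lt2.
  (* The positive quadratic is [2 L t1 - 3] minus a nonnegative term, so even [L t1 > 3 / 2]. *)
  have Lt_ge1 : 1 <= L * t1.
    have : 0 <= - mu * t1 * (2 - L * t1) by rewrite !mulr_ge0 //; lra.
    lra.
  have PL2 := PLE x2 (descent Lt_lt2).
  exact: long_step_rate PL2 gram_ge0 int12 int21 (ltW p_gt0) Lt_ge1 Lt_lt2.
- move=> t1E muE.
  have Lt1 : L * t1 = 1 by rewrite t1E mul1r mulfV // gt_eqF.
  rewrite -/F1 -/F2 -ler_pdivrMr //.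
  have -> : (2 * L - 2 * mu_p) / (2 * L + mu_p) =
    (L * t1 - 2) * (mu * t1 - 2) * mu_p * t1 / ((L + mu - mu_p) * t1 - 2) + 1.
    rewrite muE t1E; field; rewrite gt_eqF //=; lra.
  apply: middle; first by rewrite Lt1.
  (* For [mu = - L] the quadratic is [(L t1)^2 - 3 = -2]. *)
  rewrite leNgt tbar_lt muE -leNgt.
  have : (L * t1) ^+ 2 = 1 by rewrite Lt1 expr1n.
  lra.
Qed.
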